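(* Let $(M,F,\mathfrak{m})$ be a Finsler metric measure manifold with $\mathfrak{m}(M)=1$ which has normal concentration, i.e. there are positive constants $C$ and $c$ such that $\alpha_{(M,F,\mathfrak{m})}(r)\le Ce^{-cr^2}$ for every $r>0$. Then, for $q\ge1$, $(M,F,\mathfrak{m})$ satisfies $(2,q)$-Moment concentration.
   Context: A Finsler metric on a smooth manifold $M$ is a function $F:TM\to[0,\infty)$ that is $C^\infty$ on $TM\setminus\{0\}$, satisfies $F(x,\lambda y)=\lambda F(x,y)$ for $\lambda>0$, and for which $g_{ij}(x,y)=\frac12 (F^2)_{y^iy^j}(x,y)$ is positive definite for every nonzero $y\in T_xM$ ($F$ need not be reversible). A Finsler metric measure manifold $(M,F,\mathfrak{m})$ is a Finsler manifold $(M,F)$ with a positive smooth measure $\mathfrak{m}$. $M$ is connected, and the (possibly asymmetric) distance $d_F:M\times M\to[0,\infty)$ is $d_F(x_1,x_2)=\inf_\gamma\int_0^1F(\gamma(t),\dot\gamma(t))\,dt$ over $C^1$ curves $\gamma:[0,1]\to M$ from $x_1$ to $x_2$. For $A\subset M$, $r>0$: $B^{+}(A,r)=\{x\mid\inf_{z\in A}d_F(z,x)<r\}$ and $B^{-}(A,r)=\{x\mid\inf_{z\in A}d_F(x,z)<r\}$. The concentration function is $$\alpha_{(M,F,\mathfrak{m})}(r)=\sup\left\{1-\min\{\mathfrak{m}(B^{+}(A,r)),\mathfrak{m}(B^{-}(A,r))\}\;\middle|\;A\subset M\text{ Borel},\ \mathfrak{m}(A)\ge\tfrac12\right\},\quad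 r>0.$$ A function $f:M\to\mathbb{R}$ is 1-Lipschitz if $f(z)-f(x)\le d_F(x,z)$ for all $x,z\in M$. Given $p,q\ge1$, $(M,F,\mathfrak{m})$ satisfies $(p,q)$-Moment concentration if there is a positive constant $C$ such that for any 1-Lipschitz function $f$, $\left\|f-\int_Mf\,d\mathfrak{m}\right\|_{L^q(\mathfrak{m})}^p\le\frac{q}{C}$. *)

(* Defs.v *)
From HB Require Import structures.
From mathcomp Require Import all_boot all_order all_algebra.
From mathcomp Require Import all_classical all_reals all_analysis.
Set Implicit Arguments.
Unset Strict Implicit.
Unset Printing Implicit Defensive.
Import Order.TTheory GRing.Theory Num.Theory.
Import numFieldNormedType.Exports.
Local Open Scope classical_set_scope.
Local Open Scope ring_scope.

Section smooth.
Context {R : realType} {V W : normedModType R}.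

Fixpoint iter_derive (vs : seq V) (f : V -> W) : V -> W :=
  if vs is v :: vs' then 'D_v (iter_derive vs' f) else f.

(* For open U: f is infinitely (Frechet) differentiable on U.  The values of f
   outside U are irrelevant. *)
Definition smooth_on (U : set V) (f : V -> W) :=
  forall (vs : seq V) (x : V), U x -> differentiable (iter_derive vs f) x.

End smooth.

(* An n-dimensional smooth manifold is given by an atlas of charts
   [chart_map i : dom i -> R^n] with inverses [param i]; these are total functions
   that are only meaningful on [dom i], resp. on its image [cod i].
   [chart_at p] is some chart around p.  The carrier is pointed because the
   library requires it of measurable spaces; the manifolds considered below
   carry a measure of total mass 1, hence are not empty. *)
Record smooth_manifold (R : realType) (n : nat) := SmoothManifold {
  carrier :> ptopologicalType;
  carrier_hausdorff : hausdorff_space carrier;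
  carrier_second_countable : @second_countable carrier;
  chart : Type;
  dom : chart -> set carrier;
  chart_map : chart -> carrier -> 'rV[R]_n;
  param : chart -> 'rV[R]_n -> carrier;
  chart_at : carrier -> chart;
  dom_chart_at : forall p, dom (chart_at p) p;
  dom_open : forall i, open (dom i);
  cod_open : forall i, open (chart_map i @` dom i);
  chart_mapK : forall i p, dom i p -> param i (chart_map i p) = p;
  chart_map_continuous : forall i p, dom i p -> {for p, continuous (chart_map i)};
  param_continuous : forall i x, (chart_map i @` dom i) x ->
    {for x, continuous (param i)};
  transition_smooth : forall i j,
    smooth_on (chart_map i @` (dom i `&` dom j)) (chart_map j \o param i) }.

Definition cod (R : realType) (n : nat) (M : smooth_manifold R n)
    (i : chart M) : set 'rV[R]_n :=
  chart_map i @` dom i.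

Notation borel M := (g_sigma_algebraType (@open M)).

Section finsler.
Context {R : realType} {n : nat} {M : smooth_manifold R n}.

(* The tangent space at p is identified with R^n through the chart
   [chart_at p], so a function on TM is a function [F : M -> 'rV_n -> R].
   [in_chart F i x y] is then its expression in the chart i, namely
   F (p, sum_k y^k d/dx^k) with p the point of coordinates x: the components of
   this vector in the chart [chart_at p] are given by the differential of the
   change of coordinates. *)
Definition in_chart (F : M -> 'rV[R]_n -> R) (i : chart M) (x y : 'rV[R]_n) : R :=
  let p := param i x in
  F p ('D_y (chart_map (chart_at p) \o param i) x).

Definition fundamental_tensor (F : M -> 'rV[R]_n -> R) (i : chart M)
    (x y : 'rV[R]_n) : 'M[R]_n :=
  \matrix_(j, k) (2^-1 *
    'D_(delta_mx 0 j) ('D_(delta_mx 0 k) (fun y => in_chart F i x y ^+ 2)) y).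

Record finsler_metric (F : M -> 'rV[R]_n -> R) : Prop := FinslerMetric {
  finsler_ge0 : forall p y, 0 <= F p y;
  finsler_smooth : forall i : chart M,
    smooth_on [set z : 'rV[R]_n * 'rV[R]_n | cod i z.1 /\ z.2 != 0]
      (fun z => in_chart F i z.1 z.2);
  finsler_homogeneous : forall p y (l : R), 0 < l -> F p (l *: y) = l * F p y;
  finsler_posdef : forall (i : chart M) (x y : 'rV[R]_n), cod i x -> y != 0 ->
    forall w : 'rV[R]_n, w != 0 ->
      0 < (w *m fundamental_tensor F i x y *m w^T) 0 0 }.

Definition slope (f : R -> 'rV[R]_n) (t s : R) : 'rV[R]_n :=
  (s - t)^-1 *: (f s - f t).

(* Derivatives on [0, 1] are one-sided at the end points. *)
Definition derivable01 (f : R -> 'rV[R]_n) (t : R) : Prop :=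
  cvg (slope f t @ within `[0, 1] t^').

Definition derive01 (f : R -> 'rV[R]_n) (t : R) : 'rV[R]_n :=
  lim (slope f t @ within `[0, 1] t^').

(* Only the restriction of c to [0, 1] matters. *)
Definition C1_curve (c : R -> M) : Prop :=
  {within `[0, 1], continuous c} /\
  forall (i : chart M) (t : R), `[0, 1]%classic t -> dom i (c t) ->
    derivable01 (chart_map i \o c) t /\
    derive01 (chart_map i \o c) s @[s --> within `[0, 1] (nbhs t)] -->
      derive01 (chart_map i \o c) t.

Definition velocity (c : R -> M) (t : R) : 'rV[R]_n :=
  derive01 (chart_map (chart_at (c t)) \o c) t.

Definition curve_length (F : M -> 'rV[R]_n -> R) (c : R -> M) : \bar R :=
  (\int[lebesgue_measure]_(t in `[0%R, 1%R]) (F (c t) (velocity c t))%:E)%E.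

(* Typed in \bar R, but finite as soon as M is connected. *)
Definition finsler_dist (F : M -> 'rV[R]_n -> R) (x1 x2 : M) : \bar R :=
  ereal_inf [set curve_length F c | c in
    [set c | [/\ C1_curve c, c 0 = x1 & c 1 = x2]]].

Definition fwd_nbhd (F : M -> 'rV[R]_n -> R) (A : set M) (r : R) : set M :=
  [set x | (ereal_inf [set finsler_dist F z x | z in A] < r%:E)%E].

Definition bwd_nbhd (F : M -> 'rV[R]_n -> R) (A : set M) (r : R) : set M :=
  [set x | (ereal_inf [set finsler_dist F x z | z in A] < r%:E)%E].

Definition lipschitz1 (F : M -> 'rV[R]_n -> R) (f : M -> R) : Prop :=
  forall x z, ((f z - f x)%:E <= finsler_dist F x z)%E.

End finsler.

(* The Lebesgue integral over R^n of a nonnegative Borel function, as an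
   iterated integral (Tonelli). *)
Fixpoint lebesgue_int (R : realType) (n : nat) :
    ('rV[R]_n -> \bar R) -> \bar R :=
  match n with
  | 0 => fun f => f 0
  | n'.+1 => fun f =>
      (\int[lebesgue_measure]_(t in [set: R])
         lebesgue_int (fun v : 'rV[R]_n' => f (row_mx t%:M v)))%E
  end.

Definition smooth_measure (R : realType) (n : nat) (M : smooth_manifold R n)
    (m : {measure set (borel M) -> \bar R}) : Prop :=
  forall i : chart M, exists sigma : 'rV[R]_n -> R,
    [/\ smooth_on (cod i) sigma,
        (forall x, cod i x -> 0 < sigma x) &
        forall A : set (borel M), measurable A -> A `<=` dom i ->
          m A = lebesgue_int
            (fun x => (sigma x * \1_(chart_map i @` A) x)%:E)].

Section concentration.
Context {R : realType} {n : nat} {M : smooth_manifold R n}.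
Variables (F : M -> 'rV[R]_n -> R) (m : {measure set (borel M) -> \bar R}).

Definition concentration (r : R) : \bar R :=
  ereal_sup [set (1 - Order.min (m (fwd_nbhd F A r)) (m (bwd_nbhd F A r)))%E
    | A in [set A : set (borel M) | measurable A /\ ((2^-1)%:E <= m A)%E]].

Definition normal_concentration : Prop :=
  exists C c : R, [/\ 0 < C, 0 < c &
    forall r, 0 < r -> (concentration r <= (C * expR (- c * r ^+ 2))%:E)%E].

(* Integrability of f is what makes its mean meaningful. *)
Definition moment_concentration (p q : R) : Prop :=
  exists C : R, 0 < C /\ forall f : borel M -> R, lipschitz1 F f ->
    m.-integrable setT (EFin \o f) /\
    ('N[m]_(q%:E)[(fun x => (f x)%:E - \int[m]_y (f y)%:E)] `^ p
      <= (q / C)%:E)%E.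

End concentration.

(* Main.v *)
(** A set of measure at least 1/2 being given by a sublevel or superlevel of a
    1-Lipschitz f, normal concentration bounds the tails of f around an
    approximate median a by Gaussians.  Hence exp |f - a| has an integral bounded
    independently of f, which bounds |E f - a| and then all the moments of
    f - E f.

    The measure of a non-measurable set is a junk value, so one has to know that
    the neighborhoods B+(A, r) and B-(A, r) are open.  If c is a C^1 curve from x
    to z of length < r, then c can be bent near one of its end points, in a chart,
    by adding psi(t) h to it, where psi is a C^1 bump function; the new curve
    reaches a prescribed point close to that end point, is still C^1, and by
    compactness has length < r for small h.  So d(x, z) < r is an open condition
    on x and on z.  For x = z and c constant this also yields the continuity of
    1-Lipschitz functions. *)
Require Import Defs.
From mathcomp Require Import all_boot all_order all_algebra.
From mathcomp Require Import all_classical all_reals all_analysis.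
From mathcomp Require Import measurable_realfun.
From mathcomp Require Import ring lra.
Import Order.TTheory GRing.Theory Num.Theory.
Import numFieldNormedType.Exports.
Local Open Scope classical_set_scope.
Local Open Scope ring_scope.
Set Implicit Arguments.
Unset Strict Implicit.
Unset Printing Implicit Defensive.

(** * One-sided derivatives on [0, 1] and their chain rule *)

Section one_sided_derivative.
Context {R : realType}.

(** Properness makes limits along this filter unique, so that the [lim] in [derive01] can be
    computed, end points included. *)
Lemma punctured01_proper (t : R) : `[0, 1]%classic t ->
  ProperFilter (within `[0, 1] t^').
Proof.
move=> It; apply: Build_ProperFilter_ex => P.
rewrite /within/= /dnbhs /within/= => -[e /= e0 eP].
have [t0 t1] : 0 <= t /\ t <= 1 by move: It; rewrite /= in_itv/= => /andP.
(* The witness moves from [t] towards the farther end point by at most 1/2, hence stays in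
   [0, 1]. *)
have [t_half|t_half] := lerP t (1 / 2).
- exists (t + Num.min (e / 2) (1 / 2)).
  have m0 : 0 < Num.min (e / 2) (1 / 2).
    by rewrite lt_min; apply/andP; split; lra.
  have m1 : Num.min (e / 2) (1 / 2) <= e / 2 by rewrite ge_min lexx.
  have m2 : Num.min (e / 2) (1 / 2) <= 1 / 2 by rewrite ge_min lexx orbT.
  apply: eP => /=.
  + by rewrite opprD addrA subrr sub0r normrN gtr0_norm//; lra.
  + by apply/eqP; lra.
  + by rewrite in_itv/=; apply/andP; split; lra.
- exists (t - Num.min (e / 2) (1 / 2)).
  have m0 : 0 < Num.min (e / 2) (1 / 2).
    by rewrite lt_min; apply/andP; split; lra.
  have m1 : Num.min (e / 2) (1 / 2) <= e / 2 by rewrite ge_min lexx.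
  have m2 : Num.min (e / 2) (1 / 2) <= 1 / 2 by rewrite ge_min lexx orbT.
  apply: eP => /=.
  + by rewrite opprB addrCA subrr addr0 gtr0_norm//; lra.
  + by apply/eqP; lra.
  + by rewrite in_itv/=; apply/andP; split; lra.
Qed.

(** Relational form of [derivable01] and [derive01]: existence and value of the derivative are
    carried along together. *)
Definition has_derive01 n (f : R -> 'rV[R]_n) (t : R) (d : 'rV[R]_n) :=
  slope f t s @[s --> within `[0, 1] t^'] --> d.

Lemma has_derive01_derivable n (f : R -> 'rV[R]_n) t d :
  has_derive01 f t d -> derivable01 f t.
Proof. by move=> fd; apply/cvg_ex; exists d. Qed.

Lemma has_derive01E n (f : R -> 'rV[R]_n) t d : `[0, 1]%classic t ->
  has_derive01 f t d -> derive01 f t = d.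
Proof. by move=> /punctured01_proper ? fd; exact/cvg_lim. Qed.

Lemma near_eq_has_derive01 n (f g : R -> 'rV[R]_n) t d : f t = g t ->
  (\forall s \near within `[0, 1] t^', f s = g s) ->
  has_derive01 f t d -> has_derive01 g t d.
Proof.
move=> fgt fgs; apply: cvg_trans; apply: near_eq_cvg.
by apply: filterS fgs => s; rewrite /slope fgt => ->.
Qed.

Lemma within_punctured01 (t : R) (P : set R) :
  (\forall s \near within `[0, 1] (nbhs t), P s) ->
  \forall s \near within `[0, 1] t^', P s.
Proof.
by apply: (@filterS _ (nbhs t)) => s ? _.
Qed.

(** For [s != t], [f s] equals [f t + (s - t) *: slope f t s], whose second term tends to
    [0 *: d]. *)
Lemma has_derive01_cvg n (f : R -> 'rV[R]_n) t d :
  has_derive01 f t d -> f s @[s --> within `[0, 1] t^'] --> f t.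
Proof.
move=> fd.
have st : s - t @[s --> within `[0, 1] t^'] --> (0 : R).
  rewrite -[X in _ --> X](subrr t).
  apply: cvgB; last exact: cvg_cst.
  by apply: cvg_within_filter; apply: cvg_within_filter; exact: cvg_id.
have : f t + (s - t) *: slope f t s @[s --> within `[0, 1] t^'] -->
    f t + 0 *: d.
  by apply: cvgD; [exact: cvg_cst|exact: cvgZ].
rewrite scale0r addr0; apply: cvg_trans; apply: near_eq_cvg.
have : \forall s \near within `[0, 1] t^', s != t.
  by apply: (@filterS _ (nbhs t) _ setT) => //; exact: filterT.
apply: filterS => s st0.
by rewrite /slope scalerA divff ?scale1r ?subr_eq0// addrC subrK.
Qed.

Lemma has_derive01D n (f g : R -> 'rV[R]_n) t df dg :
  has_derive01 f t df -> has_derive01 g t dg ->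
  has_derive01 (f \+ g) t (df + dg).
Proof.
move=> fd gd; apply: cvg_trans (cvgD fd gd); apply: near_eq_cvg.
by apply: nearW => s; rewrite fctE /slope/= -scalerDr opprD addrACA.
Qed.

(** Turns the Landau remainder into a plain function with an explicit bound, which can be composed
    with any limit. *)
Lemma differentiable_remainder (V W : normedModType R) (g : V -> W) (x : V) :
  differentiable g x -> exists r : V -> W,
    (forall h, g (h + x) = g x + 'd g x h + r h) /\
    forall e, 0 < e -> \forall h \near 0, `|r h| <= e * `|h|.
Proof.
move=> /diff_locallyx gE; move: gE; set k := 'o _ => gE.
by exists k; split=> // e e0; exact: (littleoP [littleo of k]).
Qed.

(** The slope of [g \o v] is ['d g (v t)] applied to the slope of [v], plus a remainder quotient
    that is small relative to this slope, which stays bounded. *)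
Lemma has_derive01_comp n k (v : R -> 'rV[R]_n) (g : 'rV[R]_n -> 'rV[R]_k) t d :
  has_derive01 v t d -> differentiable g (v t) ->
  has_derive01 (g \o v) t ('D_d g (v t)).
Proof.
move=> vd dg; rewrite deriveE//.
have vt := has_derive01_cvg vd.
have [r [gE rE]] := differentiable_remainder dg.
have {}gE s : g (v s) - g (v t) = 'd g (v t) (v s - v t) + r (v s - v t).
  have := gE (v s - v t); rewrite subrK => ->.
  by rewrite addrC -[X in _ + X]addrA addKr.
rewrite /has_derive01 -[X in _ --> X]addr0.
apply: (@cvg_trans _ ('d g (v t) (slope v t s) +
    (s - t)^-1 *: r (v s - v t) @[s --> within `[0, 1] t^'])).
  apply: near_eq_cvg; apply: nearW => s.
  by rewrite {2}/slope/= gE scalerDr linearZ.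
apply: cvgD.
  have cd : continuous ('d g (v t)) by exact: diff_continuous.
  exact: (cvg_comp _ _ vd (cd d)).
apply/cvgrPdist_lt => e e0.
have M0 : 0 < `|d| + 1 by rewrite ltr_wpDl.
have sl : \forall s \near within `[0, 1] t^', `|slope v t s| < `|d| + 1.
  by apply: (cvgr_norm_lt _ vd); rewrite ltrDl.
have : v s - v t @[s --> within `[0, 1] t^'] --> (0 : 'rV[R]_n).
  by rewrite -[X in _ --> X](subrr (v t)); apply: cvgB => //; exact: cvg_cst.
(* Since the slope of [v] has norm below [|d| + 1] near [t], this factor bounds the remainder
   quotient by [e / 2]. *)
have /rE : 0 < e / (`|d| + 1) / 2.
  by rewrite !divr_gt0.
move=> /[swap]/[apply].
apply: filterS2 sl => s sl os.
rewrite sub0r normrN normrZ.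
have : `|(s - t)^-1| * `|r (v s - v t)| <= 
   e / (`|d| + 1) / 2 * `|slope v t s|.
  by rewrite /slope normrZ mulrCA ler_wpM2l.
move/le_lt_trans; apply.
have e2 : 0 < e / (`|d| + 1) / 2 by rewrite !divr_gt0.
apply: (@lt_trans _ _ (e / (`|d| + 1) / 2 * (`|d| + 1))).
  by rewrite ltr_pM2l.
by rewrite mulrAC divfK ?gt_eqF//; lra.
Qed.

End one_sided_derivative.

(** * Charts and C^1 curves *)

Section charts.
Context {R : realType} {n : nat}.

(** Joint continuity in point and direction: expanding the direction in the standard basis leaves
    only partial derivatives, which are continuous because they are themselves differentiable. *)
Lemma derive_continuous2 k (U : set 'rV[R]_n) (g : 'rV[R]_n -> 'rV[R]_k)
    (T : Type) (A : set_system T) {FA : Filter A} (v d : T -> 'rV[R]_n) x y :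
  open U -> smooth_on U g -> U x ->
  v s @[s --> A] --> x -> d s @[s --> A] --> y ->
  'D_(d s) g (v s) @[s --> A] --> 'D_y g x.
Proof.
move=> oU sg Ux vx dy.
have DE z w : U z -> 'D_w g z = \sum_j w 0 j *: 'D_(delta_mx 0 j) g z.
  move=> Uz; have dg : differentiable g z := sg [::] z Uz.
  rewrite deriveE// {1}(row_sum_delta w) linear_sum/=.
  by apply: eq_bigr => j _; rewrite linearZ deriveE.
rewrite DE//.
apply: (@cvg_trans _ (\sum_j d s 0 j *: 'D_(delta_mx 0 j) g (v s) @[s --> A])).
  apply: near_eq_cvg.
  have : \forall s \near A, U (v s) by apply: vx; exact: open_nbhs_nbhs.
  by apply: filterS => s /DE ->.
apply: cvg_big => [|j _]; first exact: add_continuous.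
apply: cvgZ.
  exact: (cvg_comp _ _ dy (@coord_continuous _ 1 n 0 j y)).
exact: (cvg_comp _ _ vx
  (differentiable_continuous (sg [:: delta_mx 0 j] x Ux))).
Qed.

Context {M : smooth_manifold R n}.
Implicit Types i j : chart M.

Lemma cod_param i x : cod i x -> dom i (param i x).
Proof. by move=> [p ip <-]; rewrite chart_mapK. Qed.

Lemma paramK i x : cod i x -> chart_map i (param i x) = x.
Proof. by move=> [p ip <-]; rewrite chart_mapK. Qed.

Lemma overlapP i j x : (chart_map i @` (dom i `&` dom j)) x <->
  cod i x /\ dom j (param i x).
Proof.
split=> [[p [ip jp] <-]|[ix jx]].
  by split; [exists p|rewrite chart_mapK].
by exists (param i x); [split=> //; exact: cod_param|exact: paramK].
Qed.

Lemma overlap_open i j : open (chart_map i @` (dom i `&` dom j)).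
Proof.
rewrite openE => x /overlapP[ix jx].
have near_cod : \forall y \near x, cod i y.
  by apply: open_nbhs_nbhs; split=> //; exact: cod_open.
have near_dom : \forall y \near x, dom j (param i y).
  apply: (param_continuous ix); apply: open_nbhs_nbhs; split=> //.
  exact: dom_open.
by rewrite /interior; apply: filterS2 near_cod near_dom => y *; apply/overlapP.
Qed.

Variable F : M -> 'rV[R]_n -> R.
Hypothesis F_finsler : finsler_metric F.

Lemma transition_differentiable i j x : cod i x -> dom j (param i x) ->
  differentiable (chart_map j \o param i) x.
Proof.
by move=> ix jx; apply: (@transition_smooth _ _ M i j [::]); exact/overlapP.
Qed.

Lemma in_chart_ge0 i x y : 0 <= in_chart F i x y.
Proof. exact: (finsler_ge0 F_finsler). Qed.

Lemma in_chartZ i x y (l : R) : cod i x -> 0 < l ->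
  in_chart F i x (l *: y) = l * in_chart F i x y.
Proof.
move=> ix l0; have dt := transition_differentiable ix (dom_chart_at (param i x)).
by rewrite /in_chart !deriveE// linearZ/= (finsler_homogeneous F_finsler).
Qed.

(** Homogeneity with the factor 2 gives [F p 0 = 2 * F p 0]. *)
Lemma finsler0 p : F p 0 = 0.
Proof.
have := finsler_homogeneous F_finsler p 0 (ltr0Sn R 1).
by rewrite scaler0; lra.
Qed.

Lemma in_chart0 i x : in_chart F i x 0 = 0.
Proof. by rewrite /in_chart derive0 finsler0. Qed.

Lemma in_chart_continuous_neq0 i x y : cod i x -> y != 0 ->
  {for (x, y), continuous (fun z => in_chart F i z.1 z.2)}.
Proof.
move=> ix y0; apply: differentiable_continuous.
by have /(_ i [::] (x, y)) := finsler_smooth F_finsler; apply.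
Qed.

Lemma unit_sphere_compact : compact [set y : 'rV[R]_n | `|y| = 1].
Proof.
apply: bounded_closed_compact.
  by exists 1; split=> // r r1 y /= ->; exact: ltW.
by apply: (@closed_comp _ _ (fun y : 'rV[R]_n => `|y|) [set 1]) => //;
  move=> y _; exact: norm_continuous.
Qed.

(* By homogeneity only the compact unit sphere matters; the smoothness of F says
   nothing at the zero section, where this bound gives the continuity. *)
Lemma in_chart_bound i x : cod i x -> exists K : R,
  \forall x' \near x, forall y, in_chart F i x' y <= K * `|y|.
Proof.
move=> ix; have near_cod : \forall y \near x, cod i y.
  by apply: open_nbhs_nbhs; split=> //; exact: cod_open.
have /compact_near_coveringP sphere := unit_sphere_compact.
(* The parameter pairs a base point tending to [x] with a bound tending to infinity, so that
   compactness yields one neighborhood and one bound for all unit vectors. *)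
have [] := sphere _ (filter_prod (nbhs x) (pinfty_nbhs R))
  (fun z y => in_chart F i z.1 y <= z.2) _.
  move=> y /= y1.
  have y0 : y != 0 by rewrite -normr_gt0 y1.
  pose W := filter_prod (nbhs y) (filter_prod (nbhs x) (pinfty_nbhs R)).
  have Wy : z.1 @[z --> W] --> y by exact: cvg_fst.
  have Wx : z.2.1 @[z --> W] --> x by exact: (cvg_comp _ _ cvg_snd cvg_fst).
  have Gxy : in_chart F i z.2.1 z.1 @[z --> W] --> in_chart F i x y.
    exact: (cvg_comp _ _ (cvg_pair Wx Wy) (in_chart_continuous_neq0 ix y0)).
  have : \forall z \near W,
      in_chart F i x y + 1 <= z.2.2.
    have Wk : z.2.2 @[z --> W] --> +oo by exact: (cvg_comp _ _ cvg_snd cvg_snd).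
    exact: cvgry_ge.
  have : \forall z \near W,
      in_chart F i z.2.1 z.1 < in_chart F i x y + 1.
    by apply: (cvgr_lt _ Gxy); rewrite ltrDl.
  by apply: filterS2 => z /ltW /le_trans; apply.
move=> [U V] /= [Ux [K [_ KV]]] UV.
(* The neighborhood of infinity [V] is only known to contain the reals strictly above [K]. *)
exists (K + 1); apply: filterS2 near_cod Ux => x' ix' Ux' y.
have [->|y0] := eqVneq y 0; first by rewrite in_chart0 normr0 mulr0.
have y1 : 0 < `|y| by rewrite normr_gt0.
have -> : y = `|y| *: (`|y|^-1 *: y) by rewrite scalerA divff ?gt_eqF// scale1r.
rewrite in_chartZ// normrZ normrZ normfV !normr_id mulVf ?gt_eqF// mulr1 mulrC.
rewrite ler_wpM2r//.
apply: (UV (x', K + 1)) => /=; first by split=> //; apply: KV; rewrite ltrDl.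
by rewrite normrZ normfV !normr_id mulVf ?gt_eqF.
Qed.

(** Off the zero section this is smoothness; on it, the values are squeezed between 0 and
    [K * |y|]. *)
Lemma in_chart_continuous i x y : cod i x ->
  {for (x, y), continuous (fun z => in_chart F i z.1 z.2)}.
Proof.
move=> ix; have [->|y0] := eqVneq y 0; last exact: in_chart_continuous_neq0.
have [K Kx] := in_chart_bound ix.
have z1 : z.1 @[z --> (x, 0 : 'rV[R]_n)] --> x by exact: cvg_fst.
have z2 : z.2 @[z --> (x, 0 : 'rV[R]_n)] --> (0 : 'rV[R]_n) by exact: cvg_snd.
rewrite /prop_for /continuous_at /= in_chart0.
apply: (@squeeze_cvgr _ _ _ _ (fun=> 0) (fun z => K * `|z.2|)).
- have : \forall z \near (x, 0 : 'rV[R]_n),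
      forall y, in_chart F i z.1 y <= K * `|y| by exact: (z1 _ Kx).
  by apply: filterS => z Kz; rewrite Kz in_chart_ge0.
- exact: cvg_cst.
- have := cvg_norm z2; rewrite normr0 => z20.
  rewrite -[X in _ --> X](mulr0 K).
  by apply: cvgM; [exact: cvg_cst|exact: z20].
Qed.

End charts.

Section C1_curves.
Context {R : realType} {n : nat} {M : smooth_manifold R n}.
Implicit Types (i j : chart M) (c : R -> M) (v dv : R -> 'rV[R]_n) (t : R).

Lemma chart_has_derive01 i j c v t d : `[0, 1]%classic t ->
  cod i (v t) -> dom j (c t) -> c t = param i (v t) ->
  (\forall s \near within `[0, 1] (nbhs t), c s = param i (v s)) ->
  has_derive01 v t d ->
  has_derive01 (chart_map j \o c) t ('D_d (chart_map j \o param i) (v t)).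
Proof.
move=> It ivt jct ct cs vd.
apply: (@near_eq_has_derive01 _ _ (chart_map j \o param i \o v)).
- by rewrite /= ct.
- by apply: within_punctured01; apply: filterS cs => s /= ->.
- apply: has_derive01_comp => //.
  by apply: transition_differentiable => //; rewrite -ct.
Qed.

(* [c] is [v] read through the chart [i] near [t], and [v] is C^1 there, with
   derivative [dv]. *)
Record C1_lift i c v dv t : Prop := C1Lift {
  lift_near : \forall s \near within `[0, 1] (nbhs t),
    [/\ cod i (v s), c s = param i (v s) & has_derive01 v s (dv s)];
  lift_derive_continuous : dv s @[s --> within `[0, 1] (nbhs t)] --> dv t }.

Lemma near_within01 t : \forall s \near within `[0, 1] (nbhs t), `[0, 1]%classic s.
Proof. by apply: (@filterS _ (nbhs t) _ setT) => //; exact: filterT. Qed.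

Lemma within_singleton (A : set R) t (P : set R) : A t ->
  (\forall s \near within A (nbhs t), P s) -> P t.
Proof. by move=> At /(@nbhs_singleton _ t) /(_ At). Qed.

Lemma has_derive01_continuous v t d : has_derive01 v t d ->
  v s @[s --> within `[0, 1] (nbhs t)] --> v t.
Proof.
move=> /has_derive01_cvg vt A /[dup] Avt /vt.
apply: (@filterS _ (nbhs t)) => s sA Is.
have [->|st] := eqVneq s t; first exact: (nbhs_singleton Avt).
exact: sA.
Qed.

(** Differentiability at a point [s] close to [t] needs information on a whole neighborhood of [s],
    hence the iterated [near]. *)
Lemma within_interior t (P : set R) :
  (\forall s \near within `[0, 1] (nbhs t), P s) ->
  \forall s \near within `[0, 1] (nbhs t),
    \forall r \near within `[0, 1] (nbhs s), P r.
Proof.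
move=> /nbhs_interior; apply: (@filterS _ (nbhs t)) => s sP _.
exact: sP.
Qed.

Lemma lift_continuous i c v dv t : `[0, 1]%classic t ->
  C1_lift i c v dv t -> v s @[s --> within `[0, 1] (nbhs t)] --> v t.
Proof.
move=> It [/(within_singleton It)[_ _ vt] _].
exact: has_derive01_continuous vt.
Qed.

Lemma lift_curve_continuous i c v dv t : `[0, 1]%classic t ->
  C1_lift i c v dv t -> c s @[s --> within `[0, 1] (nbhs t)] --> c t.
Proof.
move=> It vl; have [/[dup] near_c /(within_singleton It)[ivt ct vt] _] := vl.
rewrite ct; apply: cvg_trans; last exact:
  (cvg_comp _ _ (lift_continuous It vl) (param_continuous ivt)).
by apply: near_eq_cvg; apply: filterS near_c => s [].
Qed.

(** Chain rule for the change of coordinates, at all times near [t] and not only at [t], so that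
    continuity of the derivative can be read off. *)
Lemma lift_transition i j c v dv t : `[0, 1]%classic t ->
  C1_lift i c v dv t -> dom j (c t) ->
  \forall s \near within `[0, 1] (nbhs t),
    has_derive01 (chart_map j \o c) s
      ('D_(dv s) (chart_map j \o param i) (v s)).
Proof.
move=> It vl jct; have [near_c _] := vl.
have near_dom : \forall s \near within `[0, 1] (nbhs t), dom j (c s).
  apply: (lift_curve_continuous It vl); apply: open_nbhs_nbhs.
  by split=> //; exact: dom_open.
have near_in := near_within01 t.
have near_c2 := within_interior near_c.
near=> s.
have Is : `[0, 1]%classic s by near: s.
have [] : [/\ cod i (v s), c s = param i (v s) & has_derive01 v s (dv s)].
  by near: s.
move=> ivs cs vs.
apply: chart_has_derive01 => //; first by near: s.
have : \forall r \near within `[0, 1] (nbhs s),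
    [/\ cod i (v r), c r = param i (v r) & has_derive01 v r (dv r)].
  by near: s.
by apply: filterS => r [].
Unshelve. all: by end_near. Qed.

(** [C1_curve] speaks of every chart, but one lift per time suffices: transition maps carry it to
    the other charts, and [derive_continuous2] makes the resulting derivative continuous. *)
Lemma lift_C1_curve c :
  (forall t, `[0, 1]%classic t -> exists i v dv, C1_lift i c v dv t) ->
  C1_curve c.
Proof.
move=> cl; split.
  apply/subspace_continuousP => t It; have [i [v [dv vl]]] := cl t It.
  exact: lift_curve_continuous vl.
move=> j t It jct; have [i [v [dv vl]]] := cl t It.
have near_d := lift_transition It vl jct.
have near_in := near_within01 t.
have dct := within_singleton It near_d.
split; first exact: has_derive01_derivable dct.
rewrite (has_derive01E It dct).
have [near_c dvt] := vl.
have [ivt ct _] := within_singleton It near_c.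
apply: (@cvg_trans _ ('D_(dv s) (chart_map j \o param i) (v s)
    @[s --> within `[0, 1] (nbhs t)])).
  apply: near_eq_cvg; apply: filterS2 near_in near_d => s Is ds.
  by rewrite (has_derive01E Is ds).
apply: (derive_continuous2 (@overlap_open _ _ M i j)) => //.
- exact: transition_smooth.
- by apply/overlapP; rewrite -ct.
- exact: lift_continuous vl.
Qed.

Lemma C1_curve_lift i c t : `[0, 1]%classic t -> C1_curve c -> dom i (c t) ->
  C1_lift i c (chart_map i \o c) (derive01 (chart_map i \o c)) t.
Proof.
move=> It [/subspace_continuousP cc cd] ict.
split; last exact: (cd i t It ict).2.
have near_dom : \forall s \near within `[0, 1] (nbhs t), dom i (c s).
  by apply: (cc t It); apply: open_nbhs_nbhs; split=> //; exact: dom_open.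
have near_in := near_within01 t.
apply: filterS2 near_in near_dom => s Is ics; split.
- by exists (c s).
- by rewrite /= chart_mapK.
- exact: (cd i s Is ics).1.
Qed.

Lemma near_eq_C1_lift i c c' v dv t :
  (\forall s \near within `[0, 1] (nbhs t), c s = c' s) ->
  C1_lift i c v dv t -> C1_lift i c' v dv t.
Proof.
move=> cc' [vl dvt]; split=> //.
by apply: filterS2 cc' vl => s -> [].
Qed.

Variable F : M -> 'rV[R]_n -> R.
Hypothesis F_finsler : finsler_metric F.

Definition speed c t : R := F (c t) (velocity c t).

(** [velocity] is read in the chart [chart_at (c t)], which may jump with [t]; this computes the
    speed in any fixed chart instead. *)
Lemma lift_speed i c v dv t : `[0, 1]%classic t ->
  C1_lift i c v dv t -> speed c t = in_chart F i (v t) (dv t).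
Proof.
move=> It vl; have [near_c _] := vl.
have [_ ct _] := within_singleton It near_c.
have near_d := lift_transition It vl (dom_chart_at (c t)).
rewrite /speed /velocity (has_derive01E It (within_singleton It near_d)).
by rewrite /in_chart ct.
Qed.

(** Near [t] the speed can be read in the single chart [chart_at (c t)], where [in_chart F] is
    jointly continuous. *)
Lemma speed_continuous c : C1_curve c -> {within `[0, 1], continuous (speed c)}.
Proof.
move=> c1; apply/subspace_continuousP => t It.
pose i := chart_at (c t).
have vl := C1_curve_lift It c1 (dom_chart_at (c t)).
have [near_c dvt] := vl.
have [ivt _ _] := within_singleton It near_c.
have near_in := near_within01 t.
change (speed c s @[s --> within `[0, 1] (nbhs t)] --> speed c t).
rewrite (lift_speed It vl).
apply: cvg_trans (cvg_comp _ _ (cvg_pair (lift_continuous It vl) dvt)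
  (in_chart_continuous F_finsler ivt)).
apply: near_eq_cvg.
have near_dom : \forall s \near within `[0, 1] (nbhs t), dom i (c s).
  apply: (lift_curve_continuous It vl); apply: open_nbhs_nbhs.
  by split=> /=; [exact: dom_open|exact: dom_chart_at].
apply: filterS2 near_in near_dom => s Is ics.
by rewrite (lift_speed Is (C1_curve_lift Is c1 ics)).
Qed.

End C1_curves.

(** * A C^1 bump function on the real line *)

Section hump.
Context {R : realType}.

Definition sqr_pos (s : R) : R := Num.max 0 s ^+ 2.

(** The difference quotient is within [|h|] of the derivative; multiplied by [|h|], this is a
    polynomial inequality for each choice of signs of [s] and [s + h]. *)
Lemma is_derive_sqr_pos (s : R) : is_derive s 1 sqr_pos (2 * Num.max 0 s).
Proof.
have ds : h^-1 *: ((sqr_pos \o shift s) (h *: 1) - sqr_pos s)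
    @[h --> 0^'] --> 2 * Num.max 0 s.
  apply/cvgrPdist_lt => e e0.
  have small : \forall h \near (0 : R)^', `|h| < e by exact: dnbhs0_lt.
  have h_neq0 : \forall h \near (0 : R)^', h != 0 by exact: nbhs_dnbhs_neq.
  apply: filterS2 small h_neq0 => h he h0; apply: le_lt_trans he.
  rewrite -(ler_pM2l (_ : 0 < `|h|)) ?normr_gt0// -normrM mulrBr.
  rewrite /= /GRing.scale/= mulVKf// mulr1 -normrM ger0_norm -?expr2 ?sqr_ge0//.
  rewrite ler_norml /sqr_pos /Num.max.
  by case: ifPn => [?|]; case: ifPn => [?|]; rewrite -?leNgt => *;
    apply/andP; split; nra.
split; first by apply/cvg_ex; eexists; exact: ds.
exact/cvg_lim.
Qed.

Variables (t0 delta : R).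
Hypothesis delta0 : 0 < delta.

(** A C^1 bump of height 1 at [t0], vanishing at distance [delta] or more: the square removes the
    corner of the positive part of a parabola. *)
Definition hump (s : R) : R := sqr_pos (1 - ((s - t0) / delta) ^+ 2).

Definition dhump (s : R) : R :=
  2 * Num.max 0 (1 - ((s - t0) / delta) ^+ 2) * (- (2 * (s - t0) / delta ^+ 2)).

Lemma is_derive_hump (s : R) : is_derive s 1 hump (dhump s).
Proof.
apply: is_derive1_comp; first exact: is_derive_sqr_pos.
apply: is_derive_eq.
rewrite /GRing.scale/=.
by field; rewrite gt_eqF.
Qed.

Lemma dhump_continuous : continuous dhump.
Proof.
have cs : continuous (fun s : R => s - t0).
  by move=> s; apply: cvgB; [exact: cvg_id|exact: cvg_cst].
move=> s; apply: cvgM.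
  apply: cvgM; first exact: cvg_cst.
  suff : {for s, continuous ((cst 0 : R -> R^o) \max
      (fun s => 1 - ((s - t0) / delta) ^+ 2))} by exact.
  apply: continuous_max; first exact: cst_continuous.
  apply: cvgB; first exact: cvg_cst.
  by apply: cvgM; (apply: cvgM; [exact: cs|exact: cvg_cst]).
apply: cvgN; apply: cvgM; last exact: cvg_cst.
by apply: cvgM; [exact: cvg_cst|exact: cs].
Qed.

Lemma hump_center : hump t0 = 1.
Proof. by rewrite /hump /sqr_pos subrr mul0r expr0n subr0 max_r// expr1n. Qed.

Lemma max_hump0 s : delta <= `|s - t0| ->
  Num.max 0 (1 - ((s - t0) / delta) ^+ 2) = 0.
Proof.
move=> ds; apply/max_idPl; rewrite subr_le0 -real_normK ?num_real//.
by rewrite expr_ge1// normrM normfV (gtr0_norm delta0) ler_pdivlMr// mul1r.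
Qed.

Lemma hump_out s : delta <= `|s - t0| -> hump s = 0.
Proof. by move=> /max_hump0; rewrite /hump /sqr_pos => ->; rewrite expr0n. Qed.

End hump.

(** [is_derive] lets an increment tend to 0 whereas [slope] lets a point tend to [t]; the injective
    substitution [s - t] relates the two punctured filters. *)
Lemma has_derive01Zl {R : realType} n (psi : R -> R) (t a : R) (h : 'rV[R]_n) :
  is_derive t 1 psi a -> has_derive01 (fun s => psi s *: h) t (a *: h).
Proof.
move=> [dpsi <-].
have sub : s - t @[s --> t^'] --> (0 : R)^'.
  rewrite -(subrr t); apply: (@continuous_injective_withinNx _ _ (fun s => s - t)).
    by apply: cvgB; [exact: cvg_id|exact: cvg_cst].
  by move=> s /addIr.
have psi_slope := @cvg_within_filter _ _ _ _ (dnbhs_filter t) _ `[0, 1]%classic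
  (cvg_comp _ _ sub dpsi).
apply: cvg_trans (cvgZ psi_slope (cvg_cst h)); apply: near_eq_cvg; apply: nearW => s.
by rewrite /slope /= -scalerBl scalerA [_%:A]mulr1 subrK.
Qed.

(** * Comparison of curve lengths *)

Section curve_length.
Context {R : realType} {n : nat} {M : smooth_manifold R n}.
Variable F : M -> 'rV[R]_n -> R.
Hypothesis F_finsler : finsler_metric F.
Implicit Types (c : R -> M) (t : R).

Lemma measurable_speed c : C1_curve c ->
  measurable_fun (`[0, 1]%classic : set R) (speed F c).
Proof.
move=> /(speed_continuous F_finsler) cc.
exact: subspace_continuous_measurable_fun.
Qed.

Lemma curve_length_ge0 c : (0 <= curve_length F c)%E.
Proof. by apply: integral_ge0 => t _; rewrite lee_fin (finsler_ge0 F_finsler). Qed.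

(** The time interval has measure 1, so the constant [e] integrates to [e]. *)
Lemma curve_length_le c c' (e : R) : 0 <= e -> C1_curve c -> C1_curve c' ->
  (forall t, `[0, 1]%classic t -> speed F c' t <= speed F c t + e) ->
  (curve_length F c' <= curve_length F c + e%:E)%E.
Proof.
move=> e0 c1 c1' cc'.
have -> : (curve_length F c + e%:E)%E =
    (\int[lebesgue_measure]_(t in `[0%R, 1%R]) ((speed F c t)%:E + cst e%:E t))%E.
  rewrite ge0_integralD//=.
  - rewrite integral_cst//= lebesgue_measure_itv/= lte_fin ltr01.
    by rewrite sube0 mule1.
  - by move=> t _; rewrite lee_fin (finsler_ge0 F_finsler).
  - by apply/measurable_EFinP; exact: measurable_speed.
apply: ge0_le_integral => //=.
- by move=> t _; rewrite lee_fin (finsler_ge0 F_finsler).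
- by apply/measurable_EFinP; exact: measurable_speed.
- apply: emeasurable_funD => //.
  by apply/measurable_EFinP; exact: measurable_speed.
Qed.

End curve_length.

(** * Bending a curve near one of its points *)

Section deformation.
Context {R : realType} {n : nat} {M : smooth_manifold R n}.
Variable F : M -> 'rV[R]_n -> R.
Hypothesis F_finsler : finsler_metric F.
Variables (c : R -> M) (t0 delta : R) (i : chart M).
Hypotheses (c1 : C1_curve c) (delta0 : 0 < delta).
Hypothesis c_dom : forall s, `[0, 1]%classic s -> `|s - t0| < 2 * delta ->
  dom i (c s).

Let u s := chart_map i (c s).
Let du s := derive01 u s.

Definition bent h s := u s + hump t0 delta s *: h.
Definition dbent h s := du s + dhump t0 delta s *: h.

(** Two radii are used: the bump lives within [delta], the chart is used up to [2 * delta]. Both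
    branches agree in between, so the glued curve stays C^1. *)
Definition bent_curve h s : M :=
  if `|s - t0| < 2 * delta then param i (bent h s) else c s.

(** The compact set of times outside of which the curve is left unchanged. *)
Let J : set R := `[0, 1] `&` [set s | `|s - t0| <= delta].

Lemma bent_out h s : delta <= `|s - t0| -> bent h s = u s.
Proof. by move=> ds; rewrite /bent hump_out// scale0r addr0. Qed.

(** For [h = 0] both conditions hold and they are open in [(s, h)] jointly; compactness of [J] makes
    the neighborhood of 0 uniform in [s]. *)
Lemma bent_near (e : R) : 0 < e ->
  \forall h \near (0 : 'rV[R]_n), forall s, J s -> cod i (bent h s) /\
    in_chart F i (bent h s) (dbent h s) < in_chart F i (u s) (du s) + e.
Proof.
move=> e0.
have J_compact : compact J.
  apply: compact_closedI; first exact: segment_compact.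
  have -> : [set s | `|s - t0| <= delta] =
      (fun s : R => `|s - t0|) @^-1` [set x | x <= delta] by [].
  apply: closed_comp; last exact: closed_le.
  move=> s _; apply: cvg_norm; apply: cvgB; [exact: cvg_id|exact: cvg_cst].
have /near_covering_withinP cover : near_covering J.
  exact/compact_near_coveringP.
have : \forall h \near (0 : 'rV[R]_n), J `<=` [set s | cod i (bent h s) /\
    in_chart F i (bent h s) (dbent h s) < in_chart F i (u s) (du s) + e].
  apply: (cover _ (nbhs (0 : 'rV[R]_n)) (fun h s => cod i (bent h s) /\
    in_chart F i (bent h s) (dbent h s) < in_chart F i (u s) (du s) + e)).
  move=> s [Is /= sd]; have ics : dom i (c s).
    by apply: c_dom => //; apply: le_lt_trans sd _; rewrite ltr_pMl ?ltr1n.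
  have ius : cod i (u s) by exists (c s).
  have ul := C1_curve_lift Is c1 ics.
  have uc := lift_continuous Is ul.
  have duc := lift_derive_continuous ul.
  pose W := filter_prod (within `[0, 1] (nbhs s)) (nbhs (0 : 'rV[R]_n)).
  have W1 : z.1 @[z --> W] --> within `[0, 1] (nbhs s) by exact: cvg_fst.
  have W2 : z.2 @[z --> W] --> (0 : 'rV[R]_n) by exact: cvg_snd.
  have W1s : z.1 @[z --> W] --> s.
    by apply: cvg_trans W1 _; exact: cvg_within.
  have Wu : u z.1 @[z --> W] --> u s by exact: (cvg_comp _ _ W1 uc).
  have Wdu : du z.1 @[z --> W] --> du s by exact: (cvg_comp _ _ W1 duc).
  have Wb : bent z.2 z.1 @[z --> W] --> u s.
    have -> : u s = u s + hump t0 delta s *: 0 by rewrite scaler0 addr0.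
    apply: cvgD => //; apply: cvgZ => //; apply: (cvg_comp _ _ W1s).
    apply: differentiable_continuous; apply/derivable1_diffP.
    by case: (is_derive_hump t0 delta0 s).
  have Wdb : dbent z.2 z.1 @[z --> W] --> du s.
    have -> : du s = du s + dhump t0 delta s *: 0 by rewrite scaler0 addr0.
    apply: cvgD => //; apply: cvgZ => //; apply: (cvg_comp _ _ W1s).
    exact: dhump_continuous.
  have near_cod : \forall z \near W, cod i (bent z.2 z.1).
    by apply: Wb; apply: open_nbhs_nbhs; split=> //; exact: cod_open.
  have Gb : in_chart F i (bent z.2 z.1) (dbent z.2 z.1) @[z --> W] -->
      in_chart F i (u s) (du s).
    exact: (cvg_comp _ _ (cvg_pair Wb Wdb) (in_chart_continuous F_finsler ius)).
  have Gu : in_chart F i (u z.1) (du z.1) @[z --> W] -->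
      in_chart F i (u s) (du s).
    exact: (cvg_comp _ _ (cvg_pair Wu Wdu) (in_chart_continuous F_finsler ius)).
  (* The time varies too, so [e] is shared between passing from the bent point to [u s] and from
     [u s] to [u z.1]. *)
  have : \forall z \near W,
      in_chart F i (u s) (du s) < in_chart F i (u z.1) (du z.1) + e / 2.
    have : \forall z \near W,
        in_chart F i (u s) (du s) - e / 2 < in_chart F i (u z.1) (du z.1).
      by apply: (cvgr_gt _ Gu); rewrite gtrBl divr_gt0.
    by apply: filterS => z; rewrite ltrBlDr.
  have : \forall z \near W, in_chart F i (bent z.2 z.1) (dbent z.2 z.1) <
      in_chart F i (u s) (du s) + e / 2.
    by apply: (cvgr_lt _ Gb); rewrite ltrDl divr_gt0.
  move=> lt_bent lt_u.
  have : \forall z \near W, cod i (bent z.2 z.1) /\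
      in_chart F i (bent z.2 z.1) (dbent z.2 z.1) <
      in_chart F i (u z.1) (du z.1) + e.
    apply: filterS3 near_cod lt_bent lt_u => z ? lt1 lt2; split=> //.
    by apply: lt_trans lt1 _; lra.
  move=> [[A B] [/= sA B0] AB].
  exists ([set r | `[0, 1]%classic r -> A r], B) => //.
  by move=> [r h] [/= Ar Bh] [Ir _]; apply: (AB (r, h)); split => //; exact: Ar.
by apply: filterS => h Jh s /Jh.
Qed.

Lemma near_inside s : `|s - t0| < 2 * delta ->
  \forall r \near within `[0, 1] (nbhs s), `|r - t0| < 2 * delta.
Proof.
move=> sd; apply: (@filterS _ (nbhs s) _ [set r | `|r - t0| < 2 * delta]) => //.
have : `|r - t0| @[r --> s] --> `|s - t0|.
  by apply: cvg_norm; apply: cvgB; [exact: cvg_id|exact: cvg_cst].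
by move=> /cvgr_lt /(_ _ sd).
Qed.

Lemma near_outside s : delta < `|s - t0| ->
  \forall r \near within `[0, 1] (nbhs s), delta < `|r - t0|.
Proof.
move=> sd; apply: (@filterS _ (nbhs s) _ [set r | delta < `|r - t0|]) => //.
have : `|r - t0| @[r --> s] --> `|s - t0|.
  by apply: cvg_norm; apply: cvgB; [exact: cvg_id|exact: cvg_cst].
by move=> /cvgr_gt /(_ _ sd).
Qed.

Section fixed_end.
Variables (e : R) (h : 'rV[R]_n).
Hypothesis bent_J : forall s, J s -> cod i (bent h s) /\
    in_chart F i (bent h s) (dbent h s) < in_chart F i (u s) (du s) + e.

Lemma bent_cod s : `[0, 1]%classic s -> `|s - t0| < 2 * delta ->
  cod i (bent h s).
Proof.
move=> Is sd; have [sd'|/ltW sd'] := lerP `|s - t0| delta.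
  by case: (bent_J (conj Is sd')).
by rewrite bent_out//; exists (c s) => //; exact: c_dom.
Qed.

Lemma bent_lift s : `[0, 1]%classic s -> `|s - t0| < 2 * delta ->
  C1_lift i (bent_curve h) (bent h) (dbent h) s.
Proof.
move=> Is sd.
have near_in := near_within01 s.
have ul := C1_curve_lift Is c1 (c_dom Is sd).
split.
  apply: filterS3 near_in (near_inside sd) (lift_near ul) => r Ir rd [_ _ ur].
  split; first exact: bent_cod.
    by rewrite /bent_curve rd.
  by apply: has_derive01D ur _; exact: has_derive01Zl (is_derive_hump t0 delta0 r).
apply: cvgD; first exact: lift_derive_continuous ul.
apply: cvgZ; last exact: cvg_cst.
by apply: cvg_within_filter; exact: dhump_continuous.
Qed.

Lemma bent_curve_out s : `[0, 1]%classic s -> delta < `|s - t0| ->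
  \forall r \near within `[0, 1] (nbhs s), c r = bent_curve h r.
Proof.
move=> Is sd; have near_in := near_within01 s.
apply: filterS2 near_in (near_outside sd) => r Ir /ltW rd.
rewrite /bent_curve; case: ifPn => // rd2.
by rewrite bent_out// chart_mapK//; exact: c_dom.
Qed.

(** Within [2 * delta] of [t0] the chart [i] provides the lift; farther away the curve coincides
    locally with [c]. *)
Lemma bent_curve_C1 : C1_curve (bent_curve h).
Proof.
apply: lift_C1_curve => s Is.
have [sd|sd] := ltP `|s - t0| (2 * delta).
  by exists i, (bent h), (dbent h); exact: bent_lift.
exists (chart_at (c s)); do 2 eexists; apply: near_eq_C1_lift.
  by apply: bent_curve_out => //; apply: lt_le_trans sd; rewrite ltr_pMl ?ltr1n.
exact: C1_curve_lift Is c1 (dom_chart_at _).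
Qed.

(** The cases split at [delta]: on [J] the hypothesis on [h] applies, outside [J] both curves agree
    locally and have the same speed. *)
Lemma bent_curve_speed s : 0 <= e -> `[0, 1]%classic s ->
  speed F (bent_curve h) s <= speed F c s + e.
Proof.
move=> e0 Is; have [sd|sd] := lerP `|s - t0| delta.
  have sd2 : `|s - t0| < 2 * delta.
    by apply: le_lt_trans sd _; rewrite ltr_pMl ?ltr1n.
  rewrite (lift_speed _ Is (bent_lift Is sd2)).
  rewrite (lift_speed _ Is (C1_curve_lift Is c1 (c_dom Is sd2))).
  by apply/ltW; case: (bent_J (conj Is sd)).
have cl := C1_curve_lift Is c1 (dom_chart_at (c s)).
have bl := near_eq_C1_lift (bent_curve_out Is sd) cl.
by rewrite (lift_speed _ Is cl) (lift_speed _ Is bl) lerDl.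
Qed.

End fixed_end.

End deformation.

(** * Openness of the conditions d(x, z) < r *)

Section perturbation.
Context {R : realType} {n : nat} {M : smooth_manifold R n}.
Variable F : M -> 'rV[R]_n -> R.
Hypothesis F_finsler : finsler_metric F.

Lemma curve_perturbation (c : R -> M) (t0 t1 r : R) : C1_curve c ->
  `[0, 1]%classic t0 -> `[0, 1]%classic t1 -> t0 != t1 ->
  (curve_length F c < r%:E)%E ->
  \forall w \near c t0, exists c', [/\ C1_curve c', c' t0 = w, c' t1 = c t1 &
    (curve_length F c' < r%:E)%E].
Proof.
move=> c1 I0 I1 t01 cr.
pose i := chart_at (c t0).
have it0 : dom i (c t0) by exact: dom_chart_at.
have [d d0 c_d] : exists2 d : R, 0 < d &
    forall s, `[0, 1]%classic s -> `|s - t0| < d -> dom i (c s).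
  have := lift_curve_continuous I0 (C1_curve_lift I0 c1 it0).
  move=> /(_ (dom i)) [].
    by apply: open_nbhs_nbhs; split=> //; exact: dom_open.
  move=> d /= d0 dP; exists d => // s Is sd; apply: dP => //=.
  by rewrite distrC.
(* The first bound keeps the bending inside the chart domain, the second makes the bump vanish at
   [t1]. *)
pose delta := Num.min (d / 2) `|t1 - t0|.
have delta0 : 0 < delta.
  by rewrite lt_min divr_gt0// normr_gt0 subr_eq0 eq_sym.
have c_dom s : `[0, 1]%classic s -> `|s - t0| < 2 * delta -> dom i (c s).
  move=> Is sd; apply: c_d => //; apply: lt_le_trans sd _.
  by rewrite mulrC -ler_pdivlMr// ge_min lexx.
(* Half of the slack in the length, so that adding [e] stays strictly below [r]. *)
pose e := (r - fine (curve_length F c)) / 2.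
have c_fin : curve_length F c \is a fin_num.
  by rewrite ge0_fin_numE ?curve_length_ge0// (lt_trans cr)// ltry.
have e0 : 0 < e by rewrite divr_gt0// subr_gt0 -lte_fin fineK.
have := bent_near F_finsler c1 delta0 c_dom e0.
(* The displacement [h] is the coordinate difference between [w] and [c t0]; since the bump is 1 at
   [t0], the bent curve passes there through [w]. *)
have w0 : chart_map i w - chart_map i (c t0) @[w --> c t0] --> (0 : 'rV[R]_n).
  rewrite -(subrr (chart_map i (c t0))); apply: cvgB; last exact: cvg_cst.
  exact: chart_map_continuous.
move=> /w0 near_bent.
have near_dom : \forall w \near c t0, dom i w.
  by apply: open_nbhs_nbhs; split=> //; exact: dom_open.
apply: filterS2 near_dom near_bent => w iw /= bw.
exists (bent_curve c t0 delta i (chart_map i w - chart_map i (c t0))); split.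
- exact: bent_curve_C1 bw.
- rewrite /bent_curve subrr normr0 mulr_gt0// /bent hump_center scale1r.
  by rewrite addrC subrK chart_mapK.
- have t1d : delta <= `|t1 - t0| by rewrite ge_min lexx orbT.
  rewrite /bent_curve; case: ifPn => // t1d2.
  by rewrite bent_out// chart_mapK//; exact: c_dom.
- apply: (@le_lt_trans _ _ (curve_length F c + e%:E)%E).
    apply: curve_length_le => //; [exact: ltW|exact: bent_curve_C1 bw|].
    by move=> t It; apply: bent_curve_speed => //; exact: ltW.
  rewrite -(fineK c_fin) -EFinD lte_fin /e.
  have : fine (curve_length F c) < r by rewrite -lte_fin fineK.
  lra.
Qed.

Implicit Types x z : M.

Lemma finsler_dist_lt_near_r x z (r : R) : (finsler_dist F x z < r%:E)%E ->
  \forall w \near z, (finsler_dist F x w < r%:E)%E.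
Proof.
move=> /ereal_inf_lt[_ [c [c1 cx cz] <-] cr].
have I0 : `[0, 1]%classic (0 : R) by rewrite /= in_itv/= lexx ler01.
have I1 : `[0, 1]%classic (1 : R) by rewrite /= in_itv/= lexx ler01.
have := curve_perturbation c1 I1 I0 (oner_neq0 R) cr.
rewrite cz cx; apply: filterS => w [c' [c'1 c'w c'x c'r]].
by apply: le_lt_trans c'r; apply: ereal_inf_lbound; exists c'.
Qed.

(** The distance may be asymmetric, so moving the start point is a separate fact, with the roles of
    the times 0 and 1 exchanged. *)
Lemma finsler_dist_lt_near_l x z (r : R) : (finsler_dist F x z < r%:E)%E ->
  \forall w \near x, (finsler_dist F w z < r%:E)%E.
Proof.
move=> /ereal_inf_lt[_ [c [c1 cx cz] <-] cr].
have I0 : `[0, 1]%classic (0 : R) by rewrite /= in_itv/= lexx ler01.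
have I1 : `[0, 1]%classic (1 : R) by rewrite /= in_itv/= lexx ler01.
have t01 : (0 : R) != 1 by rewrite eq_sym oner_neq0.
have := curve_perturbation c1 I0 I1 t01 cr.
rewrite cz cx; apply: filterS => w [c' [c'1 c'w c'x c'r]].
by apply: le_lt_trans c'r; apply: ereal_inf_lbound; exists c'.
Qed.

(** The constant curve has speed 0. *)
Lemma finsler_dist_refl x : (finsler_dist F x x <= 0)%E.
Proof.
have cst_derive i (t : R) : has_derive01 (chart_map i \o cst x) t 0.
  rewrite /has_derive01 (_ : slope _ t = cst 0); first exact: cvg_cst.
  by apply/funext => s; rewrite /slope/= subrr scaler0.
have cl t : `[0, 1]%classic t ->
    C1_lift (chart_at x) (cst x) (cst (chart_map (chart_at x) x)) (cst 0) t.
  move=> It; split; last exact: cvg_cst.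
  apply: nearW => s; split; last exact: (@cst_derive (chart_at x)).
    by exists x => //; exact: dom_chart_at.
  by rewrite chart_mapK//; exact: dom_chart_at.
apply: (@le_trans _ _ (curve_length F (cst x))).
  apply: ereal_inf_lbound; exists (cst x) => //; split=> //.
  by apply: lift_C1_curve => t It; do 3 eexists; exact: cl.
rewrite /curve_length (eq_integral (cst 0%E)) ?integral_cst ?mul0e// => t.
rewrite inE => It; congr EFin.
by have := lift_speed F It (cl t It); rewrite in_chart0.
Qed.

End perturbation.

(** * From Gaussian tails to moments *)

Section tails.
Context d (T : measurableType d) (R : realType).
Variable mu : {measure set T -> \bar R}.
Hypothesis mu1 : mu [set: T] = 1%E.
Implicit Types (f Z : T -> R) (a B c C q : R).

Lemma unit_measureC (A : set T) : measurable A -> (mu A + mu (~` A) = 1)%E.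
Proof.
move=> mA; rewrite -measureU ?setUv//; first exact: measurableC.
by rewrite setICr.
Qed.

Lemma unit_measure_le1 (A : set T) : measurable A -> (mu A <= 1)%E.
Proof. by move=> mA; rewrite -mu1; apply: le_measure; rewrite ?inE. Qed.

Lemma unit_measure_fin_num (A : set T) : measurable A -> mu A \is a fin_num.
Proof.
by move=> mA; rewrite ge0_fin_numE// (le_lt_trans (unit_measure_le1 mA))// ltry.
Qed.

Lemma measurable_sublevel f a : measurable_fun [set: T] f ->
  measurable [set x | f x <= a].
Proof.
move=> mf; rewrite (_ : mkset _ = setT `&` f @^-1` `]-oo, a]%classic).
  exact: mf.
by apply/seteqP; split=> x /=; rewrite in_itv/=; [split|case].
Qed.

Lemma measurable_superlevel f a : measurable_fun [set: T] f ->
  measurable [set x | a <= f x].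
Proof.
move=> mf; rewrite (_ : mkset _ = setT `&` f @^-1` `[a, +oo[%classic).
  exact: mf.
by apply/seteqP; split=> x /=; rewrite in_itv/= andbT; [split|case].
Qed.

(** The sublevels at the integers increase to the whole space, so their measures tend to 1. *)
Lemma sublevel_gt_half f : measurable_fun [set: T] f ->
  exists a, ((2^-1)%:E < mu [set x | (f x <= a)%R])%E.
Proof.
move=> mf.
have fT : \bigcup_n [set x | f x <= n%:R] = [set: T].
  apply/seteqP; split=> // x _.
  have [k fk] : exists k : nat, `|f x| < k%:R.
    by exists (Num.bound `|f x|); exact: archi_boundP.
  by exists k => //=; rewrite (le_trans (ler_norm _))// ltW.
have : mu [set x | f x <= n%:R] @[n --> \oo] --> mu [set: T].
  rewrite -fT; apply: nondecreasing_cvg_mu.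
  - by move=> n; exact: measurable_sublevel.
  - by rewrite fT.
  - move=> n k nk; rewrite subsetEset => x /= /le_trans; apply.
    by rewrite ler_nat.
rewrite mu1 => cv1; apply: contrapT => /forallNP no.
have : (limn (fun n => mu [set x | (f x <= n%:R)%R]) <= (2^-1)%:E)%E.
  apply: lime_le; first by apply/cvg_ex; eexists; exact: cv1.
  by apply: nearW => n; rewrite leNgt; apply/negP; exact: no.
by rewrite (cvg_lim _ cv1)// lee_fin; lra.
Qed.

(** A level [b] in [S] within 1 of the supremum works: less than half of the mass lies at or below
    [b], while [b + 1] exceeds the supremum and so is not in [S]. *)
Lemma approximate_median f : measurable_fun [set: T] f -> exists a,
  ((2^-1)%:E <= mu [set x | (f x <= a + 1)%R])%E /\
  ((2^-1)%:E <= mu [set x | (a <= f x)%R])%E.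
Proof.
move=> mf; pose S := [set a | (mu [set x | (f x <= a)%R] < (2^-1)%:E)%E].
have mono a b : a <= b ->
    (mu [set x | (f x <= a)%R] <= mu [set x | (f x <= b)%R])%E.
  move=> ab; apply: le_measure; rewrite ?inE; [exact: measurable_sublevel..|].
  by move=> x /= /le_trans; apply.
have S_bound : has_ubound S.
  have [b hb] := sublevel_gt_half mf; exists b => a /= aS.
  by rewrite leNgt; apply/negP => /ltW/mono; rewrite leNgt (lt_trans aS hb).
have S_nonempty : S !=set0.
  have mfN : measurable_fun [set: T] (\- f) by exact: measurable_funN.
  have [b hb] := sublevel_gt_half mfN.
  (* The shift by 1 makes this sublevel disjoint from the set [- f x <= b], which has more than half
     of the mass. *)
  exists (- b - 1) => /=.
  have mA := measurable_sublevel b mfN.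
  have : (mu [set x | (f x <= - b - 1)%R] <= mu (~` [set x | (- f x <= b)%R]))%E.
    apply: le_measure; rewrite ?inE; [exact: measurable_sublevel|exact: measurableC|].
    by move=> x /= fx; apply/negP; rewrite -ltNge; lra.
  move=> /le_lt_trans; apply.
  have := unit_measureC mA.
  have := unit_measure_fin_num mA; have := unit_measure_fin_num (measurableC mA).
  move: hb => /=.
  case: (mu _) => //= r; case: (mu _) => //= s; rewrite !lte_fin -EFinD => + _ _ [].
  by lra.
have [b Sb supb] := sup_adherent (ltr01 : 0 < (1 : R)) (conj S_nonempty S_bound).
exists b; split.
  rewrite leNgt; apply/negP => Sb1.
  have := ub_le_sup S_bound Sb1; lra.
have mA := measurable_sublevel b mf.
apply: (@le_trans _ _ (mu (~` [set x | f x <= b]))); last first.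
  apply: le_measure; rewrite ?inE; [exact: measurableC|exact: measurable_superlevel|].
  by move=> x /= /negP; rewrite -ltNge => /ltW.
have := unit_measureC mA.
have := unit_measure_fin_num mA; have := unit_measure_fin_num (measurableC mA).
move: Sb; rewrite /S /=.
case: (mu _) => //= r; case: (mu _) => //= s; rewrite !lte_fin lee_fin -EFinD => + _ _ [].
by lra.
Qed.

(* [expR Z] is at most [expR (k + 1)] on the event [k <= Z < k + 1]. *)
Lemma expR_moment Z B : measurable_fun [set: T] Z -> (forall x, 0 <= Z x) ->
  0 <= B ->
  (forall k : nat, (mu [set x | (k%:R <= Z x)%R] <= (B * expR (- 2 * k%:R))%:E)%E) ->
  (\int[mu]_x (expR (Z x))%:E <= (2 * expR 1 * B)%:E)%E.
Proof.
move=> mZ Z0 B0 ZB.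
pose g (k : nat) x : \bar R :=
  ((expR (k%:R + 1))%:E * (\1_[set x | (k%:R <= Z x)%R] x)%:E)%E.
have mA k : measurable [set x | k%:R <= Z x] by exact: measurable_superlevel.
have g0 k x : (0 <= g k x)%E by rewrite mule_ge0// lee_fin expR_ge0.
have mg k : measurable_fun [set: T] (g k).
  apply: emeasurable_funM => //; apply/measurable_EFinP.
  exact: measurable_indic.
apply: (@le_trans _ _ (\int[mu]_x \sum_(k <oo) g k x)%E).
  apply: ge0_le_integral => //=.
  - by apply/measurable_EFinP; exact: measurableT_comp.
  - exact: ge0_emeasurable_sum.
  (* The single term with [k] the integer part of [Z x] already dominates [expR (Z x)]. *)
  move=> x _; rewrite (@nneseriesD1 _ _ (Num.trunc (Z x)))//.
  have /andP[kZ Zk] := truncn_itv (Z0 x).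
  rewrite -[leLHS]adde0; apply: leeD; last by apply: nneseries_ge0.
  rewrite /g indicE mem_set//= mule1 lee_fin ler_expR.
  by rewrite ltW// natr1.
rewrite integral_nneseries//.
(* Comparison with a geometric series whose weights [1 / 2 ^ k.+1] sum to 1. *)
apply: (@le_trans _ _
    (\sum_(k <oo) ((2 * expR 1 * B) / (2 ^ k.+1)%:R)%:E)%E); last first.
  by apply: (epsilon_trick0 xpredT); rewrite !mulr_ge0// expR_ge0.
apply: lee_nneseries => [k _ _|k _].
  by apply: integral_ge0 => x _.
rewrite /g ge0_integralZl//= ?lee_fin ?expR_ge0//.
  rewrite integral_indic// setIT.
  apply: (@le_trans _ _ ((expR (k%:R + 1))%:E * (B * expR (- 2 * k%:R))%:E)%E).
    by apply: lee_wpmul2l => //; rewrite lee_fin expR_ge0.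
  rewrite -EFinM lee_fin expnS natrM invfM.
  have -> : expR (k%:R + 1) * (B * expR (- 2 * k%:R)) =
      B * (expR (- k%:R) * expR (1 : R)).
    by rewrite mulrCA -!expRD; congr (_ * expR _); ring.
  have -> : 2 * expR 1 * B * (2^-1 * (2 ^ k)%:R^-1) =
      B * ((2 ^ k)%:R^-1 * expR (1 : R)) by field; rewrite pnatr_eq0 expn_eq0.
  rewrite ler_wpM2l// ler_wpM2r ?expR_ge0//.
  (* What remains is [2 ^ k <= expR k], which follows from [1 + 1 <= expR 1]. *)
  rewrite expRN lef_pV2 ?posrE ?expR_gt0 ?ltr0n ?expn_gt0//.
  rewrite natrX -[X in expR X]mulr1 expRM_natl lerXn2r ?nnegrE ?expR_ge0//.
  by have := expR_ge1Dx (1 : R); lra.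
by apply/measurable_EFinP; exact: measurable_indic.
Qed.

End tails.

(** Writing [y] as [q * (y / q)], this is the [q]-th power of [y / q <= expR (y / q)]. *)
Lemma powR_le_expR (R : realType) (q y : R) : 0 < q -> 0 <= y ->
  y `^ q <= q `^ q * expR y.
Proof.
move=> q0 y0; rewrite -{1}(divfK (lt0r_neq0 q0) y) mulrC powRM ?(ltW q0)//; last first.
  by rewrite divr_ge0// ltW.
rewrite ler_wpM2l ?powR_ge0//.
rewrite -[X in _ <= expR X](divfK (lt0r_neq0 q0) y) expRM.
rewrite ge0_ler_powR ?nnegrE ?expR_ge0 ?divr_ge0 ?(ltW q0)//.
by have := expR_ge1Dx (y / q); lra.
Qed.

Section moments.
Context d (T : measurableType d) (R : realType).
Variable mu : {measure set T -> \bar R}.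
Hypothesis mu1 : mu [set: T] = 1%E.
Implicit Types (f : T -> R) (a B c C q : R).

(** The level [a] is arbitrary in each half, because an approximate median supplies different levels
    for the upper and the lower tail. *)
Definition gaussian_tails f C c := forall a r, 0 < r ->
  (((2^-1)%:E <= mu [set x | (f x <= a)%R])%E ->
    (mu [set x | (a + r <= f x)%R] <= (C * expR (- c * r ^+ 2))%:E)%E) /\
  (((2^-1)%:E <= mu [set x | (a <= f x)%R])%E ->
    (mu [set x | (f x <= a - r)%R] <= (C * expR (- c * r ^+ 2))%:E)%E).

(* Accounts for [- c * r ^+ 2 <= c^-1 - 2 * r] and for the shift by 1 of the
   approximate median. *)
Let tail_constant C c : R := expR 2 * (1 + 2 * C * expR c^-1).

(** Only the center [a] depends on [f], not the constant. The rate 2 is what [expR_moment] asks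
    for. *)
Lemma gaussian_tails_exponential f C c : 0 < C -> 0 < c ->
  measurable_fun [set: T] f -> gaussian_tails f C c ->
  exists a, forall k : nat, (mu [set x | (k%:R <= `|f x - a|)%R] <=
    (tail_constant C c * expR (- 2 * k%:R))%:E)%E.
Proof.
move=> C0 c0 mf ft.
have [a [ha1 ha2]] := approximate_median mu1 mf.
have mZ : measurable_fun [set: T] (fun x => `|f x - a|).
  by apply: measurableT_comp => //; apply: measurable_funB.
have tc1 : expR 2 <= tail_constant C c.
  rewrite ler_peMr ?expR_ge0// lerDl !mulr_ge0 ?expR_ge0 ?(ltW C0)//.
exists a => k.
have mk : measurable [set x | k%:R <= `|f x - a|] by exact: measurable_superlevel.
(* For [k <= 1] the right-hand side is at least 1, thanks to the factor [expR 2]. *)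
have [k1|k1] := leqP k 1.
  apply: (le_trans (unit_measure_le1 mu1 mk)).
  rewrite lee_fin; apply: (@le_trans _ _ (expR 2 * expR (-2 * k%:R))).
    rewrite -expRD -[leLHS]expR0 ler_expR.
    have : (k%:R : R) <= 1 by rewrite -[leRHS]/(1%:R) ler_nat.
    lra.
  by rewrite ler_wpM2r ?expR_ge0.
(* The upper tail starts from [a + 1], so [a + 1 + r] is exactly [a + k]; the lower tail is merely
   enlarged. *)
pose r : R := k%:R - 1.
have r0 : 0 < r by rewrite subr_gt0 -[ltLHS]/(1%:R) ltr_nat.
have [hu _] := ft (a + 1) r r0; have [_ hl] := ft a r r0.
have {}hu := hu ha1; have {}hl := hl ha2.
have mu_u := measurable_superlevel (a + 1 + r) mf.
have mu_l := measurable_sublevel (a - r) mf.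
apply: (@le_trans _ _ (mu ([set x | a + 1 + r <= f x] `|` [set x | f x <= a - r]))).
  apply: le_measure; rewrite ?inE//; first exact: measurableU.
  move=> x /=; rewrite /r ler_normr => /orP[kx|kx]; [left|right]; lra.
apply: (le_trans (measureU2 mu mu_u mu_l)).
apply: (le_trans (leeD hu hl)); rewrite -EFinD lee_fin.
(* Completing the square: the difference of the exponents is [(c * r - 1) ^+ 2 / c]. *)
have : expR (- c * r ^+ 2) <= expR 2 * expR c^-1 * expR (- 2 * k%:R).
  rewrite -!expRD ler_expR -subr_ge0.
  rewrite (_ : _ - _ = (c * r - 1) ^+ 2 / c); first by rewrite divr_ge0 ?sqr_ge0 ?ltW.
  by rewrite /r; field; rewrite gt_eqF.
move=> /(ler_wpM2l (ltW C0)) le1.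
have : 0 <= expR 2 * expR (- 2 * k%:R) :> R by rewrite mulr_ge0 ?expR_ge0.
rewrite /tail_constant; lra.
Qed.

Lemma integrable_cst1 a : mu.-integrable [set: T] (EFin \o cst a).
Proof.
apply/integrableP; split; first exact/measurable_EFinP.
rewrite (eq_integral (cst `|a|%:E))// integral_cst// mu1 mule1.
exact: ltry.
Qed.

(** [K] is fixed before [f]. [L] bounds the integral of [expR |f - a|], [D] the [q]-th moment about
    the mean, and [E] the squared norm; [K = q / E] makes [q / K] equal to [E]. *)
Lemma gaussian_tails_moment C c q : 0 < C -> 0 < c -> 1 <= q ->
  exists K, 0 < K /\ forall f, measurable_fun [set: T] f -> gaussian_tails f C c ->
    mu.-integrable [set: T] (EFin \o f) /\
    ('N[mu]_(q%:E)[(fun x => (f x)%:E - \int[mu]_y (f y)%:E)] `^ 2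
      <= (q / K)%:E)%E.
Proof.
move=> C0 c0 q1; have q0 : 0 < q by lra.
pose L : R := 2 * expR 1 * tail_constant C c.
have tc0 : 0 < tail_constant C c.
  by rewrite mulr_gt0 ?expR_gt0// ltr_wpDr// !mulr_ge0 ?expR_ge0 ?(ltW C0).
have L0 : 0 < L by rewrite /L mulr_gt0// mulr_gt0// expR_gt0.
pose D : R := q `^ q * expR L * L.
have D0 : 0 < D by rewrite /D mulr_gt0// mulr_gt0 ?expR_gt0 ?powR_gt0.
pose E : R := (D `^ q^-1) `^ 2.
have E0 : 0 < E by rewrite !powR_gt0.
exists (q / E); split; first by rewrite divr_gt0.
move=> f mf ft; rewrite invf_div mulrCA divff ?gt_eqF// mulr1.
have [a fa] := gaussian_tails_exponential C0 c0 mf ft.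
have mfa : measurable_fun [set: T] (fun x => f x - a) by exact: measurable_funB.
have mZ : measurable_fun [set: T] (fun x => `|f x - a|).
  by apply: measurableT_comp.
have me : measurable_fun [set: T] (fun x => (expR `|f x - a|)%:E).
  by apply/measurable_EFinP; exact: measurableT_comp.
have eL : (\int[mu]_x (expR `|f x - a|)%:E <= L%:E)%E.
  by apply: expR_moment => //; exact: ltW.
have ie : mu.-integrable [set: T] (fun x => (expR `|f x - a|)%:E).
  apply/integrableP; split=> //.
  rewrite (eq_integral (fun x => (expR `|f x - a|)%:E)).
    by apply: le_lt_trans eL _; exact: ltry.
  by move=> x _; rewrite abse_EFin ger0_norm ?expR_ge0.
have le_expR (y : R) : y <= expR y by have := expR_ge1Dx y; lra.
have ifa : mu.-integrable [set: T] (fun x => (f x - a)%:E).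
  apply: le_integrable ie => //; first exact/measurable_EFinP.
  by move=> x _; rewrite !abse_EFin lee_fin [leRHS]ger0_norm ?expR_ge0.
have int_f : mu.-integrable [set: T] (EFin \o f).
  have := integrableD measurableT ifa (integrable_cst1 a).
  by apply: eq_integrable => // x _ /=; rewrite -EFinD subrK.
split=> //.
pose b := fine (\int[mu]_y (f y)%:E)%E.
have bE : (\int[mu]_y (f y)%:E)%E = b%:E.
  by rewrite fineK//; exact: integrable_fin_num.
(* The mean is within the integral of [|f - a|] of [a], and [|f - a|] is below its exponential. *)
have ab : `|b - a| <= L.
  rewrite -lee_fin -abse_EFin EFinB -bE.
  have -> : a%:E = (\int[mu]_x (cst a x)%:E)%E.
    by rewrite -[RHS]/(\int[mu]_x (cst a%:E x))%E integral_cst// mu1 mule1.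
  rewrite -integralB_EFin//; last exact: integrable_cst1.
  apply: le_trans (le_abse_integral _ _ _) _ => //; first exact/measurable_EFinP.
  apply: le_trans eL; apply: ge0_le_integral => //.
    by apply/measurable_EFinP.
  by move=> x _; rewrite lee_fin.
rewrite bE unlock /=.
(* Pointwise, [powR_le_expR] and [|f - b| <= |f - a| + L] replace the power by a multiple of
   [expR |f - a|]. *)
have mom : (\int[mu]_x (`|f x - b| `^ q)%:E <= D%:E)%E.
  apply: (@le_trans _ _ (\int[mu]_x ((q `^ q * expR L)%:E * (expR `|f x - a|)%:E))%E).
    apply: ge0_le_integral => //=.
    - apply/measurable_EFinP; apply: (measurableT_comp (measurable_powR q)).
      by apply: measurableT_comp => //; exact: measurable_funB.
    - exact: emeasurable_funM.
    move=> x _; rewrite lee_fin.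
    apply: le_trans (powR_le_expR q0 (normr_ge0 _)) _.
    rewrite -mulrA ler_wpM2l ?powR_ge0// -expRD ler_expR.
    have -> : f x - b = (f x - a) - (b - a) by ring.
    by apply: le_trans (ler_normB _ _) _; rewrite addrC lerD2r.
  rewrite ge0_integralZl//=.
  - rewrite [leRHS]EFinM; apply: lee_wpmul2l => //.
    by rewrite lee_fin mulr_ge0 ?powR_ge0 ?expR_ge0.
  - by rewrite lee_fin mulr_ge0 ?powR_ge0 ?expR_ge0.
apply: (@le_trans _ _ ((D%:E `^ q^-1) `^ 2)%E); last by rewrite !poweR_EFin.
have i0 : (0 <= \int[mu]_x (`|f x - b| `^ q)%:E)%E.
  by apply: integral_ge0 => x _; rewrite lee_fin powR_ge0.
apply: gt0_ler_poweR; rewrite ?in_itv/= ?leey ?andbT ?poweR_ge0 ?lee_fin ?powR_ge0//.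
rewrite -poweR_EFin; apply: gt0_ler_poweR;
  by rewrite ?in_itv/= ?leey ?andbT ?invr_ge0 ?(ltW q0) ?lee_fin ?(ltW D0).
Qed.

End moments.

(** * Lipschitz functions and their tails under concentration *)

Section lipschitz_functions.
Context {R : realType} {n : nat} {M : smooth_manifold R n}.
Variable F : M -> 'rV[R]_n -> R.
Hypothesis F_finsler : finsler_metric F.
Implicit Types (A : set M) (f : M -> R) (r : R).

Lemma fwd_nbhd_open A r : open (fwd_nbhd F A r).
Proof.
rewrite openE => x /ereal_inf_lt[_ [z Az <-] zx].
apply: filterS (finsler_dist_lt_near_r F_finsler zx) => w zw.
by apply: le_lt_trans zw; apply: ereal_inf_lbound; exists z.
Qed.

Lemma bwd_nbhd_open A r : open (bwd_nbhd F A r).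
Proof.
rewrite openE => x /ereal_inf_lt[_ [z Az <-] xz].
apply: filterS (finsler_dist_lt_near_l F_finsler xz) => w wz.
by apply: le_lt_trans wz; apply: ereal_inf_lbound; exists z.
Qed.

(** Since d(x, x) is at most 0, both d(x, w) and d(w, x) are below [e] for [w] near [x]; each of
    them controls one sign of the difference. *)
Lemma lipschitz1_continuous f : lipschitz1 F f -> continuous f.
Proof.
move=> lf x; apply/cvgrPdist_lt => e e0.
have xx : (finsler_dist F x x < e%:E)%E.
  by apply: le_lt_trans (finsler_dist_refl F_finsler x) _; rewrite lte_fin.
apply: filterS2 (finsler_dist_lt_near_r F_finsler xx)
  (finsler_dist_lt_near_l F_finsler xx) => w xw wx.
rewrite ltr_norml -!lte_fin; apply/andP; split.
  rewrite EFinN lteNl -EFinN opprB; exact: le_lt_trans (lf x w) xw.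
exact: le_lt_trans (lf w x) wx.
Qed.

Lemma open_borel (A : set M) : open A -> measurable (A : set (borel M)).
Proof. by move=> oA; apply: sub_sigma_algebra. Qed.

Lemma lipschitz1_measurable f : lipschitz1 F f ->
  measurable_fun [set: borel M] (f : borel M -> R).
Proof.
move=> /lipschitz1_continuous/continuousP cf.
apply: (measurability _ (RGenOpens.measurableE R)).
move=> _ [_ [a [b ->] <-]]; rewrite setTI; apply: open_borel.
exact/cf/interval_open.
Qed.

Variable m : {measure set (borel M) -> \bar R}.
Hypothesis m_total : m [set: borel M] = 1%E.

(** If [B] misses one of the two neighborhoods, its complement has measure at least their minimum;
    either side suffices. *)
Lemma concentration_lb (A B : set (borel M)) r : measurable A ->
  ((2^-1)%:E <= m A)%E -> measurable B ->
  (fwd_nbhd F A r `<=` ~` B \/ bwd_nbhd F A r `<=` ~` B) ->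
  (m B <= concentration F m r)%E.
Proof.
move=> mA A2 mB AB.
have mF : measurable (fwd_nbhd F A r : set (borel M)).
  by apply: open_borel; exact: fwd_nbhd_open.
have mG : measurable (bwd_nbhd F A r : set (borel M)).
  by apply: open_borel; exact: bwd_nbhd_open.
apply: (@le_trans _ _
    (1 - Order.min (m (fwd_nbhd F A r)) (m (bwd_nbhd F A r)))%E); last first.
  by apply: ereal_sup_ubound; exists A.
have : (Order.min (m (fwd_nbhd F A r)) (m (bwd_nbhd F A r)) <= m (~` B))%E.
  rewrite ge_min; apply/orP; case: AB => AB; [left|right];
    by apply: le_measure; rewrite ?inE//; exact: measurableC.
have := unit_measureC m_total mB.
have Bfin := unit_measure_fin_num m_total mB.
have Cfin := unit_measure_fin_num m_total (measurableC mB).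
have minfin : Order.min (m (fwd_nbhd F A r)) (m (bwd_nbhd F A r)) \is a fin_num.
  by rewrite /Order.min; case: ifP => _; exact: unit_measure_fin_num.
move: Bfin Cfin minfin.
case: (m B) => //= s _; case: (m (~` B)) => //= t _; case: (Order.min _ _) => //= u _.
rewrite -EFinD => -[] st; rewrite !lee_fin; lra.
Qed.

(** Moving forward by less than [r] raises [f] by less than [r]: this keeps B+ of a sublevel off the
    upper tail and, read in reverse, B- of a superlevel off the lower tail. *)
Lemma lipschitz1_gaussian_tails f (C c : R) : lipschitz1 F f ->
  (forall r, 0 < r -> (concentration F m r <= (C * expR (- c * r ^+ 2))%:E)%E) ->
  gaussian_tails m (f : borel M -> R) C c.
Proof.
move=> lf conc a r r0; have mf := lipschitz1_measurable lf.
split=> ha; apply: le_trans (conc r r0).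
- apply: (concentration_lb (measurable_sublevel a mf) ha).
    exact: measurable_superlevel mf.
  left=> x /ereal_inf_lt[_ [z /= za <-] zx] /= xa.
  by have := le_lt_trans (lf z x) zx; rewrite lte_fin; lra.
- apply: (concentration_lb (measurable_superlevel a mf) ha).
    exact: measurable_sublevel mf.
  right=> x /ereal_inf_lt[_ [z /= za <-] xz] /= xa.
  by have := le_lt_trans (lf x z) xz; rewrite lte_fin; lra.
Qed.

End lipschitz_functions.

Theorem theorem3p14 (R : realType) (n : nat) (M : smooth_manifold R n)
    (F : M -> 'rV[R]_n -> R) (m : {measure set (borel M) -> \bar R})
    (M_connected : connected [set: M])
    (F_finsler : finsler_metric F)
    (m_smooth : smooth_measure m)
    (m_total : m [set: borel M] = 1%E)
    (m_normal : normal_concentration F m)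
    (q : R) (q_ge1 : 1 <= q) :
  moment_concentration F m 2 q.
Proof.
have [C [c [C0 c0 conc]]] := m_normal.
have [K [K0 moment]] := gaussian_tails_moment m_total C0 c0 q_ge1.
exists K; split=> // f lf; apply: moment.
- exact: lipschitz1_measurable F_finsler _ lf.
- exact: (lipschitz1_gaussian_tails F_finsler m_total lf conc).
Qed.
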